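(* Let $X=\mathbb{P}^1\times\mathbb{P}^1$ over an algebraically closed field of characteristic $0$, let $D\subset X$ be an irreducible curve of type $(a,b)$ with $a\ge b\ge0$, and let $\epsilon=1-1/m$ with $m\ge2$ an integer. Then $b\ge1$ unless $(a,b)=(1,0)$, and: (1) if $a\le2$, that is $(a,b)\in\{(1,0),(1,1),(2,1),(2,2)\}$, then $-(K_X+\epsilon D)$ is ample for every $m\ge2$; (2) if $a=3$, that is $(a,b)\in\{(3,1),(3,2),(3,3)\}$, then $-(K_X+\epsilon D)$ is ample if and only if $m=2$, nef if and only if $m\in\{2,3\}$, and big if and only if $m=2$; (3) if $a=4$, that is $(a,b)\in\{(4,1),(4,2),(4,3),(4,4)\}$, then $-(K_X+\epsilon D)$ is nef if and only if $m=2$, and it is then neither ample nor big; (4) if $a\ge5$, then $-(K_X+\epsilon D)$ is not nef for any $m\ge2$. Every type listed in (1)–(3) is represented by a smooth irreducible curve.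
   Context: $\operatorname{Pic}(X)=\mathbb{Z}H_1\oplus\mathbb{Z}H_2$ with $H_1,H_2$ the two ruling classes, $H_1^2=H_2^2=0$, $H_1\cdot H_2=1$, and $-K_X=2H_1+2H_2$. A curve $D$ has type $(a,b)$ if $D\equiv aH_1+bH_2$. *)

(* Defs.v *)
From HB Require Import structures.
From mathcomp Require Import all_boot all_order all_algebra.
From mathcomp Require Import mpoly.

Set Implicit Arguments.
Unset Strict Implicit.
Unset Printing Implicit Defensive.

Import Order.TTheory GRing.Theory Num.Theory.
Local Open Scope ring_scope.

(* Points of a projective space are given by nonzero vectors of homogeneous
   coordinates, up to this relation. *)
Definition same_point (K : fieldType) (n : nat) (u v : 'rV[K]_n) : Prop :=
  exists2 c : K, c != 0 & u = c *: v.

(* A pair of homogeneous coordinate vectors, i.e. a representative of a point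
   of X = P^1 x P^1. *)
Record bipoint (K : fieldType) := Bipoint {
  px : 'rV[K]_2;
  py : 'rV[K]_2;
  px_neq0 : px != 0;
  py_neq0 : py != 0 }.

(* The bihomogeneous coordinate ring K[x_0, x_1, y_0, y_1] of X is
   {mpoly K[2 + 2]}: the variables of index lshift 2 i are the x_i and those
   of index rshift 2 j are the y_j. *)
Definition at_bipoint (K : fieldType) (F : {mpoly K[2 + 2]}) (P : bipoint K) : K :=
  F.@[fun i => row_mx (px P) (py P) 0 i].

Definition at_point (K : fieldType) (n : nat) (G : {mpoly K[n]}) (z : 'rV[K]_n) : K :=
  G.@[fun i => z 0 i].

(* F is bihomogeneous of bidegree (p, q), i.e. F is a global section of the
   line bundle O_X(p, q) = O_X(p H_1 + q H_2). The bidegree is a pair of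
   integers; only F = 0 qualifies when p < 0 or q < 0. *)
Definition bihomog (K : fieldType) (p q : int) (F : {mpoly K[2 + 2]}) : Prop :=
  forall m, m \in msupp F ->
    (\sum_(i < 2) m (lshift 2 i))%N%:Z = p /\
    (\sum_(j < 2) m (rshift 2 j))%N%:Z = q.

Definition irreducible_mpoly (K : fieldType) (n : nat) (F : {mpoly K[n]}) : Prop :=
  [/\ F != 0, F \isn't a GRing.unit &
      forall G H : {mpoly K[n]}, F = G * H ->
        G \is a GRing.unit \/ H \is a GRing.unit].

(* The subset D of X is an irreducible (and reduced) curve, and D is the
   divisor of the section F of O_X(a H_1 + b H_2). *)
Definition curve_equation (K : fieldType) (D : bipoint K -> Prop) (a b : nat)
    (F : {mpoly K[2 + 2]}) : Prop :=
  [/\ bihomog a b F, irreducible_mpoly F &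
      forall P, D P <-> at_bipoint F P = 0].

Definition irreducible_curve (K : fieldType) (D : bipoint K -> Prop) (a b : nat) : Prop :=
  exists F, curve_equation D a b F.

(* Jacobian criterion in bihomogeneous coordinates. By the two Euler relations,
   the four partial derivatives of F vanish at a zero P of F if and only if the
   two partial derivatives of the dehomogenization of F vanish at P, in any
   standard affine chart containing P. *)
Definition smooth_irreducible_curve (K : fieldType) (D : bipoint K -> Prop)
    (a b : nat) : Prop :=
  exists2 F, curve_equation D a b F &
    forall P, D P -> exists i : 'I_(2 + 2), at_bipoint (mderiv i F) P != 0.

(* Pic(X) (x) Q, in coordinates with respect to the basis (H1, H2). *)
Definition PicQ := 'rV[rat]_2.
Definition H1 : PicQ := delta_mx 0 0.
Definition H2 : PicQ := delta_mx 0 1.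

Definition classQ (x y : rat) : PicQ := x *: H1 + y *: H2.
Definition classZ (p q : int) : PicQ := classQ p%:~R q%:~R.

(* H1 and H2 are the classes of O_X(1, 0) and O_X(0, 1): H1^2 = H2^2 = 0, H1.H2 = 1. *)
Definition intersection (L M : PicQ) : rat := L 0 0 * M 0 1 + L 0 1 * M 0 0.

Definition KX : PicQ := - (2 *: H1 + 2 *: H2).

Definition epsilon (m : nat) : rat := 1 - m%:R^-1.

Definition nef (K : fieldType) (L : PicQ) : Prop :=
  forall (C : bipoint K -> Prop) (c d : nat),
    irreducible_curve C c d -> 0 <= intersection L (classZ c d).

Definition proj_map (K : fieldType) (N : nat) (s : 'I_N.+1 -> {mpoly K[2 + 2]})
    (P : bipoint K) : 'rV[K]_N.+1 := \row_i at_bipoint (s i) P.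

(* z is (a representative of) a point of the image of [s_0 : ... : s_N]. *)
Definition in_image (K : fieldType) (N : nat) (s : 'I_N.+1 -> {mpoly K[2 + 2]})
    (z : 'rV[K]_N.+1) : Prop :=
  exists P, same_point z (proj_map s P).

(* For sections s_0, ..., s_N of one line bundle, phi = [s_0 : ... : s_N] is a
   closed embedding of X in P^N: phi is everywhere defined, its image is Zariski
   closed, and phi has an inverse phi(X) -> P^1 x P^1 which is a morphism, that
   is, around each point of phi(X) both components of the inverse are given by
   pairs of forms of equal degree in the coordinates of P^N. The last condition
   contains the injectivity of phi. *)
Definition closed_embedding (K : fieldType) (N : nat)
    (s : 'I_N.+1 -> {mpoly K[2 + 2]}) : Prop :=
  [/\ forall P, proj_map s P != 0,
      exists2 E : {mpoly K[N.+1]} -> Prop,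
        forall e, E e -> exists d : nat, e \is d.-homog &
        forall z : 'rV[K]_N.+1, z != 0 ->
          (in_image s z <-> forall e, E e -> at_point e z = 0) &
      forall P0, exists (d d' : nat) (G G' : 'I_2 -> {mpoly K[N.+1]}),
        let g P := \row_i at_point (G i) (proj_map s P) in
        let g' P := \row_i at_point (G' i) (proj_map s P) in
        [/\ forall i, G i \is d.-homog /\ G' i \is d'.-homog,
            g P0 != 0 /\ g' P0 != 0 &
            forall P, g P != 0 -> g' P != 0 ->
              same_point (g P) (px P) /\ same_point (g' P) (py P)]].

Definition very_ample (K : fieldType) (p q : int) : Prop :=
  exists (N : nat) (s : 'I_N.+1 -> {mpoly K[2 + 2]}),
    (forall i, bihomog p q (s i)) /\ closed_embedding s.

Definition ampleZ (K : fieldType) (p q : int) : Prop :=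
  exists2 k : nat, (0 < k)%N & very_ample K (p *+ k) (q *+ k).

Definition ample (K : fieldType) (L : PicQ) : Prop :=
  exists (r : nat) (p q : int),
    [/\ (0 < r)%N, L *+ r = classZ p q & ampleZ K p q].

(* h^0(X, O_X(p, q)) = n: the space of sections has a basis of size n. *)
Definition h0 (K : fieldType) (p q : int) (n : nat) : Prop :=
  exists2 s : 'I_n -> {mpoly K[2 + 2]},
    forall i, bihomog p q (s i) &
    forall F, bihomog p q F ->
      exists! c : 'rV[K]_n, F = \sum_(i < n) c 0 i *: s i.

(* h^0(X, kL) grows like k^(dim X). *)
Definition bigZ (K : fieldType) (p q : int) : Prop :=
  exists2 c : rat, 0 < c &
    exists k0 : nat, forall k : nat, (k0 <= k)%N ->
      exists2 n : nat, h0 K (p *+ k) (q *+ k) n & c * (k ^ 2)%:R <= n%:R.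

Definition big (K : fieldType) (L : PicQ) : Prop :=
  exists (r : nat) (p q : int),
    [/\ (0 < r)%N, L *+ r = classZ p q & bigZ K p q].

(* The class of -(K_X + epsilon D), with epsilon = 1 - 1/m, for D of type (a, b). *)
Definition adjoint_class (a b m : nat) : PicQ :=
  - (KX + epsilon m *: classZ a b).

Definition types_le2 : seq (nat * nat) := [:: (1, 0); (1, 1); (2, 1); (2, 2)]%N.
Definition types_eq3 : seq (nat * nat) := [:: (3, 1); (3, 2); (3, 3)]%N.
Definition types_eq4 : seq (nat * nat) := [:: (4, 1); (4, 2); (4, 3); (4, 4)]%N.

(* Main.v *)
Require Import Defs.
From HB Require Import structures.
From mathcomp Require Import all_boot all_order all_algebra.
From mathcomp Require Import mpoly zify ring.

(* Everything follows from the positivity of L = x H1 + y H2: it is ample, or big, if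
   and only if x and y are positive, and nef if and only if they are nonnegative.

   If x, y > 0, a multiple of L is an integral class (p, q) embedding X by the
   Segre-Veronese map; its image is cut out by the quadrics Z_ij Z_kl = Z_i'j' Z_k'l'
   with i + k = i' + k' and j + l = j' + l', and consecutive coordinates give the inverse.
   If p <= 0, sections of O_X(p, q) do not depend on x, so they do not separate the points
   of a fibre, and h^0(kp, kq) grows at most linearly in k. Nefness is tested on fibres.

   A form of bidegree (a, 0) is a product of linear forms, so b = 0 forces a = 1. The smooth
   curves are the pencils x0^a (y0^b - y1^b) + x1^a (y0^b + y1^b): the factors of a
   bihomogeneous polynomial are bihomogeneous, and if both factors had positive degree in x,
   they would both vanish at the only point of the curve over [1 : 1], which would be
   singular. *)

Set Implicit Arguments.
Unset Strict Implicit.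
Unset Printing Implicit Defensive.

Import Order.TTheory GRing.Theory Num.Theory.
Local Open Scope ring_scope.

(** * Bihomogeneous polynomials *)

Section BigradedMonomials.

Implicit Types m : 'X_{1..2 + 2}.

(** The degrees in x and in y are declared as measures so that the theory of [dhomog] applies to
    each of the two gradings separately. *)
Definition xdeg m : nat := \sum_(i < 2) m (lshift 2 i).
Definition ydeg m : nat := \sum_(j < 2) m (rshift 2 j).

Lemma xdeg0 : xdeg 0%MM = 0%N.
Proof. by rewrite /xdeg big1 // => i _; rewrite mnm0E. Qed.

Lemma xdegD : {morph xdeg : m1 m2 / (m1 + m2)%MM >-> (m1 + m2)%N}.
Proof. by move=> m1 m2; rewrite /xdeg -big_split; apply: eq_bigr => i _; rewrite mnmDE. Qed.

Lemma ydeg0 : ydeg 0%MM = 0%N.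
Proof. by rewrite /ydeg big1 // => i _; rewrite mnm0E. Qed.

Lemma ydegD : {morph ydeg : m1 m2 / (m1 + m2)%MM >-> (m1 + m2)%N}.
Proof. by move=> m1 m2; rewrite /ydeg -big_split; apply: eq_bigr => i _; rewrite mnmDE. Qed.

HB.instance Definition _ := isMeasure.Build (2 + 2) xdeg xdeg0 xdegD.
HB.instance Definition _ := isMeasure.Build (2 + 2) ydeg ydeg0 ydegD.

(** Exponent of x0^i x1^(p-i) y0^j y1^(q-j). Subtraction is truncated, so the bidegree is (p, q)
    only when i <= p and j <= q. *)
Definition bimon (p q i j : nat) : 'X_{1..2 + 2} :=
  [multinom match split k with
            | inl k' => if k' == 0%R then i else (p - i)%N
            | inr k' => if k' == 0%R then j else (q - j)%N
            end | k < 2 + 2].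

Lemma bimon_x p q i j (k : 'I_2) :
  bimon p q i j (lshift 2 k) = if k == 0 then i else (p - i)%N.
Proof. by rewrite mnmE (unsplitK (inl k)). Qed.

Lemma bimon_y p q i j (k : 'I_2) :
  bimon p q i j (rshift 2 k) = if k == 0 then j else (q - j)%N.
Proof. by rewrite mnmE (unsplitK (inr k)). Qed.

Lemma xdeg_bimon p q i j : (i <= p)%N -> xdeg (bimon p q i j) = p.
Proof. by move=> le_ip; rewrite /xdeg 2!big_ord_recl big_ord0 !bimon_x addn0 subnKC. Qed.

Lemma ydeg_bimon p q i j : (j <= q)%N -> ydeg (bimon p q i j) = q.
Proof. by move=> le_jq; rewrite /ydeg 2!big_ord_recl big_ord0 !bimon_y addn0 subnKC. Qed.

Lemma bimonK m : bimon (xdeg m) (ydeg m) (m (lshift 2 0)) (m (rshift 2 0)) = m.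
Proof.
apply/mnmP => k; rewrite -(splitK k) /xdeg /ydeg !big_ord_recl !big_ord0 !addn0.
case: (split k) => -[[|[|//]] lt_k2] /=; rewrite ?bimon_x ?bimon_y /= ?addKn;
  by congr (m _); apply: val_inj.
Qed.

Lemma bimon_inj p q i j i' j' :
  bimon p q i j = bimon p q i' j' -> i = i' /\ j = j'.
Proof.
move=> /mnmP e; split.
  by have := e (lshift 2 0); rewrite !bimon_x.
by have := e (rshift 2 0); rewrite !bimon_y.
Qed.

Lemma xdeg_le_x m (k : 'I_2) : (m (lshift 2 k) <= xdeg m)%N.
Proof. by rewrite /xdeg (bigD1 k) //= leq_addr. Qed.

Lemma ydeg_le_y m (k : 'I_2) : (m (rshift 2 k) <= ydeg m)%N.
Proof. by rewrite /ydeg (bigD1 k) //= leq_addr. Qed.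

Lemma deg_x (k : 'I_2) : xdeg U_(lshift 2 k)%MM = 1%N /\ ydeg U_(lshift 2 k)%MM = 0%N.
Proof.
split; last by apply: big1 => i _; rewrite mnm1E eq_lrshift.
rewrite /xdeg (bigD1 k) //= mnm1E eqxx big1 // => i.
by rewrite mnm1E eq_lshift eq_sym => /negPf->.
Qed.

Lemma deg_y (k : 'I_2) : xdeg U_(rshift 2 k)%MM = 0%N /\ ydeg U_(rshift 2 k)%MM = 1%N.
Proof.
split; first by apply: big1 => i _; rewrite mnm1E eq_rlshift.
rewrite /ydeg (bigD1 k) //= mnm1E eqxx big1 // => i.
by rewrite mnm1E eq_rshift eq_sym => /negPf->.
Qed.

End BigradedMonomials.

Lemma sum_mxvec (V : nmodType) m n (f : 'I_(m * n) -> V) :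
  \sum_k f k = \sum_(i < m) \sum_(j < n) f (mxvec_index i j).
Proof.
by rewrite (reindex _ (curry_mxvec_bij _ _)) /= pair_big; apply: eq_bigr => -[].
Qed.

(** The rational normal curve [v1^p : v0 v1^(p-1) : ... : v0^p], with coordinates in the order used
    by [bimon]. *)
Definition veronese (R : nzRingType) p (v : 'rV[R]_2) : 'rV[R]_p.+1 :=
  \row_i (v 0 0 ^+ i * v 0 1 ^+ (p - i)).

Section Sections.

Variable K : fieldType.
Implicit Types (F G H : {mpoly K[2 + 2]}) (P : bipoint K).

Lemma bihomogP (p q : nat) F :
  bihomog p q F <-> F \is p.-homog for xdeg /\ F \is q.-homog for ydeg.
Proof.
split=> [homF | [/dhomogP homx /dhomogP homy] m mF].
  by split; apply/dhomogP => m /homF[/eqP + /eqP]; rewrite !eqz_nat => /eqP ? /eqP.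
by split; congr Posz; [exact: homx | exact: homy].
Qed.

Lemma bihomogD (p q : int) F G : bihomog p q F -> bihomog p q G -> bihomog p q (F + G).
Proof. by move=> homF homG m /msuppD_le; rewrite mem_cat => /orP[/homF | /homG]. Qed.

Lemma bihomogZ (p q : int) c F : bihomog p q F -> bihomog p q (c *: F).
Proof. by move=> homF m /msuppZ_le/homF. Qed.

Lemma bihomogB (p q : int) F G : bihomog p q F -> bihomog p q G -> bihomog p q (F - G).
Proof. by move=> homF homG; rewrite -scaleN1r; apply/bihomogD/bihomogZ. Qed.

Lemma bihomogM (p q p' q' : nat) F G :
  bihomog p q F -> bihomog p' q' G -> bihomog (p + p')%N (q + q')%N (F * G).
Proof.
move=> /bihomogP[Fx Fy] /bihomogP[Gx Gy].
by apply/bihomogP; split; apply: dhomogM.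
Qed.

Lemma bihomogXn (p q : nat) F n : bihomog p q F -> bihomog (p * n)%N (q * n)%N (F ^+ n).
Proof. by move=> /bihomogP[Fx Fy]; apply/bihomogP; split; apply: dhomogMn. Qed.

Lemma bihomog_x (k : 'I_2) : bihomog 1 0 ('X_(lshift 2 k) : {mpoly K[2 + 2]}).
Proof.
have [ex ey] := deg_x k.
by apply/(bihomogP 1 0); rewrite !dhomogX; split; apply/eqP.
Qed.

Lemma bihomog_y (k : 'I_2) : bihomog 0 1 ('X_(rshift 2 k) : {mpoly K[2 + 2]}).
Proof.
have [ex ey] := deg_y k.
by apply/(bihomogP 0 1); rewrite !dhomogX; split; apply/eqP.
Qed.

Lemma bihomog_bimon (p q i j : nat) : (i <= p)%N -> (j <= q)%N ->
  bihomog p q ('X_[K, bimon p q i j]).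
Proof.
move=> ip jq; apply/bihomogP; rewrite !dhomogX.
by split; apply/eqP; [apply: xdeg_bimon | apply: ydeg_bimon].
Qed.

(** Once the bidegree is fixed, a monomial is determined by its exponents of x0 and y0. Evaluation
    and dimension counts both go through this expansion. *)
Lemma bihomog_sum (p q : nat) F : bihomog p q F ->
  F = \sum_(i < p.+1) \sum_(j < q.+1) F@_(bimon p q i j) *: 'X_[bimon p q i j].
Proof.
move=> /bihomogP[/dhomogP homx /dhomogP homy]; apply/mpolyP => m.
rewrite raddf_sum /=; under eq_bigr do rewrite raddf_sum /=.
have [mF | /memN_msupp_eq0 Fm0] := boolP (m \in msupp F); last first.
  rewrite Fm0 big1 // => i _; rewrite big1 // => j _; rewrite mcoeffZ mcoeffX.
  by case: eqP => [->|]; rewrite ?Fm0 ?mul0r ?mulr0.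
have xm := homx _ mF; have ym := homy _ mF.
have ip : (m (lshift 2 0%R) < p.+1)%N by rewrite -xm ltnS xdeg_le_x.
have jq : (m (rshift 2 0%R) < q.+1)%N by rewrite -ym ltnS ydeg_le_y.
have em : bimon p q (m (lshift 2 0)) (m (rshift 2 0)) = m by rewrite -xm -ym bimonK.
rewrite (bigD1 (Ordinal ip)) //= (bigD1 (Ordinal jq)) //= em mcoeffZ mcoeffX eqxx mulr1.
rewrite [X in _ + X + _]big1 ?addr0 => [|j ne_j].
  rewrite big1 ?addr0 // => i ne_i; rewrite big1 // => j _.
  rewrite mcoeffZ mcoeffX; case: eqP => [e|]; rewrite ?mulr0 //.
  by case/negP: ne_i; apply/eqP/val_inj; rewrite /= -e bimon_x.
rewrite mcoeffZ mcoeffX; case: eqP => [e|]; rewrite ?mulr0 //.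
by case/negP: ne_j; apply/eqP/val_inj; rewrite /= -e bimon_y.
Qed.

Lemma at_bipointD F G P : at_bipoint (F + G) P = at_bipoint F P + at_bipoint G P.
Proof. exact: mevalD. Qed.

Lemma at_bipointM F G P : at_bipoint (F * G) P = at_bipoint F P * at_bipoint G P.
Proof. exact: mevalM. Qed.

Lemma at_bipoint_bimon p q (i : 'I_p.+1) (j : 'I_q.+1) P :
  at_bipoint 'X_[bimon p q i j] P = veronese p (px P) 0 i * veronese q (py P) 0 j.
Proof.
rewrite /at_bipoint mevalX big_split_ord /= !mxE !big_ord_recl !big_ord0 !mulr1.
have e1 : lift 0 0 = 1 :> 'I_2 by apply: val_inj.
rewrite !e1.
by rewrite !row_mxEl !row_mxEr !bimon_x !bimon_y.
Qed.

Lemma at_bipoint_sum (p q : nat) F P : bihomog p q F ->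
  at_bipoint F P = \sum_(i < p.+1) \sum_(j < q.+1)
    F@_(bimon p q i j) * (veronese p (px P) 0 i * veronese q (py P) 0 j).
Proof.
move=> homF; rewrite {1}/at_bipoint {1}(bihomog_sum homF) rmorph_sum.
apply: eq_bigr => i _; rewrite rmorph_sum; apply: eq_bigr => j _ /=.
by rewrite mevalZ -at_bipoint_bimon.
Qed.

Definition bimons p q : 'M[{mpoly K[2 + 2]}]_(p.+1, q.+1) :=
  \matrix_(i, j) 'X_[bimon p q i j].

Lemma bihomog_bimons (p q : nat) k : bihomog p q (mxvec (bimons p q) 0 k).
Proof.
case/mxvec_indexP: k => i j; rewrite mxvecE mxE.
by apply: bihomog_bimon; rewrite -ltnS.
Qed.

Lemma mcoeff_bimons p q (c : 'rV[K]_(p.+1 * q.+1)) (i : 'I_p.+1) (j : 'I_q.+1) :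
  (\sum_k c 0 k *: mxvec (bimons p q) 0 k)@_(bimon p q i j) = c 0 (mxvec_index i j).
Proof.
rewrite raddf_sum sum_mxvec /= (bigD1 i) //= (bigD1 j) //= big1 => [|j' ne_j].
  rewrite addr0 big1 => [|i' ne_i].
    by rewrite addr0 mcoeffZ mxvecE mxE mcoeffX eqxx mulr1.
  rewrite big1 // => j' _; rewrite mcoeffZ mxvecE mxE mcoeffX.
  case: eqP => [/bimon_inj[/val_inj e _]|]; rewrite ?mulr0 //.
  by rewrite e eqxx in ne_i.
rewrite mcoeffZ mxvecE mxE mcoeffX.
case: eqP => [/bimon_inj[_ /val_inj e]|]; rewrite ?mulr0 //.
by rewrite e eqxx in ne_j.
Qed.

Lemma h0_nat (p q : nat) : h0 K p q (p.+1 * q.+1).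
Proof.
exists (fun k => mxvec (bimons p q) 0 k) => [k | F homF]; first exact: bihomog_bimons.
exists (mxvec (\matrix_(i, j) F@_(bimon p q i j))); split=> [|c Fc].
  rewrite sum_mxvec {1}(bihomog_sum homF).
  by apply: eq_bigr => i _; apply: eq_bigr => j _; rewrite !mxvecE !mxE.
apply/rowP => k; case/mxvec_indexP: k => i j; rewrite mxvecE mxE.
by rewrite Fc mcoeff_bimons.
Qed.

Lemma bihomog_neg (p q : int) F : (p < 0) || (q < 0) -> bihomog p q F -> F = 0.
Proof.
move=> neg homF; apply/msuppnil0; case E: (msupp F) => [//|m s].
have [ep eq_] := homF m (eq_ind_r (fun t => m \in t) (mem_head m s) E).
by rewrite -ep -eq_ in neg.
Qed.

Lemma h0_neg (p q : int) : (p < 0) || (q < 0) -> h0 K p q 0.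
Proof.
move=> neg; exists (fun=> 0) => [[]// | F /(bihomog_neg neg) ->].
exists 0; split; first by rewrite big_ord0.
by move=> c _; apply/rowP => -[].
Qed.

(** Each family is expressed in the other by matrices A and B; uniqueness of coordinates gives A B =
    1, hence the inequality. In particular the n in [h0] is well defined. *)
Lemma h0_leq (p q : int) n n' : h0 K p q n -> h0 K p q n' -> (n <= n')%N.
Proof.
move=> [s homs genK] [s' homs' genK'].
have coord m m' (u : 'I_m -> {mpoly K[2 + 2]}) (t : 'I_m' -> {mpoly K[2 + 2]}) :
    (forall i, exists! c : 'rV[K]_m', u i = \sum_j c 0 j *: t j) ->
    exists A : 'M[K]_(m, m'), forall i, u i = \sum_j A i j *: t j.
  move=> uE; have /fin_all_exists[c {}uE] i :
    exists c : 'rV[K]_m', u i = \sum_j c 0 j *: t j by have [c []] := uE i; exists c.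
  exists (\matrix_i c i) => i.
  by rewrite uE; apply: eq_bigr => j _; rewrite mxE.
have [A sE] := coord _ _ _ _ (fun i => genK' _ (homs i)).
have [B s'E] := coord _ _ _ _ (fun i => genK _ (homs' i)).
apply: (@mulmx1_min _ _ _ A B); apply/row_matrixP => i.
have [c [_ c_uniq]] := genK _ (homs i).
rewrite -(c_uniq (row i (A *m B))) ?(c_uniq (row i 1%:M)) //.
  rewrite (bigD1 i) //= big1 => [|k ne_k]; rewrite !mxE ?eqxx ?scale1r ?addr0 //.
  by rewrite eq_sym (negPf ne_k) scale0r.
rewrite {1}sE; under eq_bigr do rewrite s'E scaler_sumr.
rewrite exchange_big /=; apply: eq_bigr => k _; rewrite !mxE scaler_suml.
by apply: eq_bigr => j _; rewrite scalerA.
Qed.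

End Sections.

(** * Classes and bigness *)

Lemma classQ_H1 x y : classQ x y 0 0 = x.
Proof. by rewrite !mxE /= mulr1 mulr0 addr0. Qed.

Lemma classQ_H2 x y : classQ x y 0 1 = y.
Proof. by rewrite !mxE /= mulr1 mulr0 add0r. Qed.

Lemma ord2P (i : 'I_2) : i = 0 \/ i = 1.
Proof. by case: i => [[|[|//]] ?]; [left | right]; apply: val_inj. Qed.

Lemma row2P (R : Type) (u v : 'rV[R]_2) : u 0 0 = v 0 0 -> u 0 1 = v 0 1 -> u = v.
Proof. by move=> e0 e1; apply/rowP => i; have [->|->] := ord2P i. Qed.

Lemma intersection_classZ (L : PicQ) (c d : nat) :
  intersection L (classZ c d) = L 0 0 * d%:R + L 0 1 * c%:R.
Proof. by rewrite /intersection classQ_H1 classQ_H2. Qed.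

(** Makes the choice of the multiple in the definitions of [ample] and [big] harmless: only the
    signs of the coordinates will matter. *)
Lemma classZ_sgn (L : PicQ) r p q : (0 < r)%N -> L *+ r = classZ p q ->
  (0 < L 0 0) = (0 < p) /\ (0 < L 0 1) = (0 < q).
Proof.
move=> r_gt0 e.
have := congr1 (fun M : PicQ => M 0 0) e; have := congr1 (fun M : PicQ => M 0 1) e.
rewrite /= classQ_H1 classQ_H2 !mulmxnE => e1 e0.
by rewrite -(pmulrn_lgt0 _ r_gt0) e0 -(pmulrn_lgt0 (L 0 1) r_gt0) e1 !ltr0z.
Qed.

Lemma classZ_multiple (L : PicQ) :
  exists (r : nat) (p q : int), (0 < r)%N /\ L *+ r = classZ p q.
Proof.
pose x : rat := L 0 0; pose y : rat := L 0 1.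
(* The product of the two denominators clears both coordinates at once. *)
exists `|(denq x * denq y)%R|%N, (numq x * denq y), (numq y * denq x); split.
  by rewrite absz_gt0 mulf_neq0 ?denq_neq0.
have e0 : (denq x)%:~R != 0 :> rat by rewrite intr_eq0 denq_neq0.
have e1 : (denq y)%:~R != 0 :> rat by rewrite intr_eq0 denq_neq0.
have er : `|(denq x * denq y)%R|%N%:R = (denq x)%:~R * (denq y)%:~R :> rat.
  by rewrite -intrM natr_absz ger0_norm // mulr_ge0 // denq_ge0.
apply: row2P; rewrite mulmxnE /classZ ?classQ_H1 ?classQ_H2 -mulr_natr er intrM.
  by rewrite -/x -{1}(divq_num_den x) mulrA divfK.
by rewrite -/y -{1}(divq_num_den y) [(denq x)%:~R * _]mulrC mulrA divfK.
Qed.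

Section Big.

Variable K : fieldType.

(** If one degree is negative there are no sections. Otherwise one degree is 0 and h^0 is the other
    plus 1, which is linear growth along multiples. *)
Lemma h0_bound (p q : int) n : (p <= 0) || (q <= 0) -> h0 K p q n ->
  (n <= `|p| + `|q| + 1)%N.
Proof.
move=> npos h0n; have [neg | ] := boolP ((p < 0) || (q < 0)).
  by have := h0_leq h0n (h0_neg K neg); lia.
case: p q npos h0n => [p|p] [q|q] npos h0n; try lia.
move=> _; have := h0_leq h0n (h0_nat K p q).
have [->|->] : p = 0%N \/ q = 0%N by lia.
  by rewrite mul1n; lia.
by rewrite muln1; lia.
Qed.

Lemma bigZ_gt0 (p q : int) : bigZ K p q <-> 0 < p /\ 0 < q.
Proof.
split=> [[c c_gt0 [k0 bigpq]] | []].
  suff: ~~ ((p <= 0) || (q <= 0)) by rewrite negb_or -!ltNge => /andP.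
  apply/negP => npos; pose M := (`|p| + `|q|)%N.
  (* On the k-th multiple h^0 is at most M k + 1 <= (M + 1) k, and k > (M + 1) / c makes this
     smaller than c k^2. *)
  pose k := (k0 + (Num.bound (M.+1%:R / c)).+1)%N.
  have k_gt0 : (0 < k)%N by rewrite /k addnS.
  have [n h0n] := bigpq k (leq_addr _ _).
  apply/negP; rewrite -ltNge.
  have le_n : (n <= M.+1 * k)%N.
    have := h0_bound _ h0n; rewrite !pmulrn_lle0 // => /(_ npos).
    have abszMn (z : int) : `|z *+ k|%N = (`|z| * k)%N by rewrite -mulr_natr abszM; lia.
    by rewrite !abszMn -mulnDl -/M; lia.
  apply: le_lt_trans (_ : (M.+1 * k)%:R < _); first by rewrite ler_nat.
  rewrite natrM expnS expn1 natrM mulrA ltr_pM2r ?ltr0n //.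
  rewrite mulrC -ltr_pdivrMr //; apply: lt_le_trans (_ : (Num.bound (M.+1%:R / c))%:R <= _).
    by apply: archi_boundP; rewrite divr_ge0 ?ler0n ?ltW.
  by rewrite ler_nat /k; lia.
case: p q => [p|//] [q|//]; rewrite !ltz_nat => p_gt0 q_gt0.
(* The growth constant 1 works because (p k + 1)(q k + 1) >= k^2. *)
exists 1 => //; exists 0%N => k _.
exists ((p * k).+1 * (q * k).+1)%N; last first.
  by rewrite mul1r ler_nat expnS expn1 leq_mul // leqW // leq_pmull.
have -> : (p : int) *+ k = (p * k)%N by lia.
have -> : (q : int) *+ k = (q * k)%N by lia.
exact: h0_nat.
Qed.

Lemma big_gt0 (L : PicQ) : big K L <-> 0 < L 0 0 /\ 0 < L 0 1.
Proof.
split=> [[r [p [q [r_gt0 eL /bigZ_gt0 bigpq]]]]|].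
  by have [-> ->] := classZ_sgn r_gt0 eL.
have [r [p [q [r_gt0 eL]]]] := classZ_multiple L.
have [-> ->] := classZ_sgn r_gt0 eL.
by move=> /bigZ_gt0 bigpq; exists r, p, q.
Qed.

End Big.

(** * Ample classes *)

Section Ample.

Variable K : fieldType.
Implicit Types (F : {mpoly K[2 + 2]}) (P : bipoint K).

Lemma veronese_neq0 p (v : 'rV[K]_2) : v != 0 -> exists i, veronese p v 0 i != 0.
Proof.
move=> v_neq0; have [v0 | v0_neq0] := eqVneq (v 0 0) 0; last first.
  by exists ord_max; rewrite mxE subnn mulr1 expf_neq0.
exists ord0; rewrite mxE mul1r expf_neq0 //; apply: contraNneq v_neq0 => v1.
by apply/eqP/row2P; rewrite !mxE.
Qed.

(** Coordinates i + 1 and i in degree p + 1 are in the ratio v0 : v1, so two consecutive coordinates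
    recover the point. *)
Lemma veronese_S p (v : 'rV[K]_2) (i : 'I_p.+1) :
  veronese p.+1 v 0 (lift ord0 i) = veronese p v 0 i * v 0 0 /\
  veronese p.+1 v 0 (widen_ord (leqnSn _) i) = veronese p v 0 i * v 0 1.
Proof.
rewrite !mxE lift0 subSS /= subSn -1?ltnS // !exprS; split; ring.
Qed.

(* Either u 0 0 <> 0, or the relations u_i^2 = u_(i-1) u_(i+1) leave only the point
   [0 : ... : 0 : 1]. *)
Lemma rational_normal_curve p (u : 'rV[K]_p.+2) : u != 0 ->
    (forall i k i' k' : 'I_p.+2, (i + k = i' + k')%N -> u 0 i * u 0 k = u 0 i' * u 0 k') ->
  exists (c : K) (v : 'rV[K]_2), [/\ c != 0, v != 0 & u = c *: veronese p.+1 v].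
Proof.
move=> u_neq0 rel; have [u0 | u0_neq0] := eqVneq (u 0 0) 0; last first.
  (* In the chart where u_0 is nonzero the point is [t : 1]; the relation u_(i+1) u_0 = u_i u_1
     gives u_i = u_0 t^i by induction. *)
  pose t := u 0 1 / u 0 0; pose v : 'rV[K]_2 := \row_i (if i == 0 then t else 1).
  exists (u 0 0), v; split=> //.
    by apply/eqP => /rowP/(_ 1); rewrite !mxE /= => /eqP; rewrite oner_eq0.
  apply/rowP => -[i lt_i]; rewrite !mxE /= expr1n mulr1.
  elim: i lt_i => [|i IHi] lt_i; first by rewrite expr0 mulr1; congr (u 0 _); apply: val_inj.
  apply: (mulIf u0_neq0); have lt_i' := ltnW lt_i.
  rewrite (rel _ _ (Ordinal lt_i') 1) /=; last by rewrite addn0 addn1.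
  by rewrite IHi exprS /t; field.
have u_lt i : (i < p.+1)%N -> forall lt_i : (i < p.+2)%N, u 0 (Ordinal lt_i) = 0.
  elim: i => [|i IHi] lt_ip lt_i; first by rewrite -u0; congr (u 0 _); apply: val_inj.
  have lt_i2 : (i.+2 < p.+2)%N by [].
  apply/eqP; rewrite -sqrf_eq0 expr2.
  rewrite (rel _ _ (Ordinal (ltnW lt_i)) (Ordinal lt_i2)) /=; last by lia.
  by rewrite IHi ?mul0r // ltnW.
have u_max_neq0 : u 0 ord_max != 0.
  apply: contraNneq u_neq0 => u_max; apply/eqP/rowP => i; rewrite mxE.
  have [-> // | lt_i] := eqVneq i ord_max; case: i lt_i => i lt_i ne_i.
  by apply: u_lt; rewrite -val_eqE /= in ne_i; lia.
pose v : 'rV[K]_2 := \row_i (if i == 0 then 1 else 0).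
exists (u 0 ord_max), v; split=> //.
  by apply/eqP => /rowP/(_ 0); rewrite !mxE /= => /eqP; rewrite oner_eq0.
apply/rowP => i; rewrite !mxE /= expr1n mul1r.
have [-> | ne_i] := eqVneq i ord_max; first by rewrite subnn mulr1.
case: i ne_i => i lt_i; rewrite -val_eqE /= => ne_i.
have lt_ip : (i < p.+1)%N by lia.
by rewrite (u_lt i lt_ip) expr0n subn_eq0 leqNgt lt_ip mulr0.
Qed.

(** The row and the column through a nonzero entry Z i0 j0 lie on rational normal curves, and the
    relation Z i j Z i0 j0 = Z i j0 Z i0 j rebuilds the whole matrix from them. This also explains
    the constant a b / Z i0 j0. *)
Lemma segre_veronese p q (Z : 'M[K]_(p.+2, q.+2)) : Z != 0 ->
    (forall (i k i' k' : 'I_p.+2) (j l j' l' : 'I_q.+2),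
      (i + k = i' + k')%N -> (j + l = j' + l')%N -> Z i j * Z k l = Z i' j' * Z k' l') ->
  exists (c : K) (v w : 'rV[K]_2), [/\ c != 0, v != 0, w != 0 &
    forall i j, Z i j = c * (veronese p.+1 v 0 i * veronese q.+1 w 0 j)].
Proof.
move=> /matrix0Pn[i0 [j0 Z0]] rel.
have [|i k i' k' e|a [v [a_neq0 v_neq0 uE]]] := @rational_normal_curve p (\row_i Z i j0).
- by apply/rV0Pn; exists i0; rewrite mxE.
- by rewrite !mxE; apply: rel.
have [|j l j' l' e|b [w [b_neq0 w_neq0 wE]]] := @rational_normal_curve q (\row_j Z i0 j).
- by apply/rV0Pn; exists j0; rewrite mxE.
- by rewrite !mxE; apply: rel.
exists (a * b / Z i0 j0), v, w; split=> [|//|//|i j].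
  by rewrite !mulf_neq0 ?invr_eq0.
apply: (mulIf Z0); rewrite (rel i i0 i i0 j j0 j0 j) //; last exact: addnC.
have := congr1 (fun u : 'rV_ _ => u 0 i) uE; rewrite !mxE => ->.
have := congr1 (fun u : 'rV_ _ => u 0 j) wE; rewrite !mxE => ->.
by field.
Qed.

(** The index type has the shape ['I_N.+1] required by [closed_embedding]; it is convertible to
    ['I_(p.+1 * q.+1)], the indices of the flattened matrix of monomials. *)
Definition bimon_section p q : 'I_(p.+1 * q.+1).-1.+1 -> {mpoly K[2 + 2]} :=
  fun k : 'I_(p.+1 * q.+1) => mxvec (bimons K p q) 0 k.

Lemma proj_map_bimon p q P (i : 'I_p.+1) (j : 'I_q.+1) :
  proj_map (@bimon_section p q) P 0 (mxvec_index i j) =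
  veronese p (px P) 0 i * veronese q (py P) 0 j.
Proof.
rewrite mxE /bimon_section /= -at_bipoint_bimon; congr at_bipoint.
by rewrite (mxvecE (bimons K p q)) mxE.
Qed.

Definition quadric N (k l k' l' : 'I_N) : {mpoly K[N]} := 'X_k * 'X_l - 'X_k' * 'X_l'.

Lemma at_point_X N (k : 'I_N) (z : 'rV[K]_N) : at_point 'X_k z = z 0 k.
Proof. exact: mevalXU. Qed.

Lemma at_point_quadric N (k l k' l' : 'I_N) (z : 'rV[K]_N) :
  at_point (quadric k l k' l') z = z 0 k * z 0 l - z 0 k' * z 0 l'.
Proof. by rewrite /at_point mevalB !mevalM !mevalXU. Qed.

Definition bimon_relation p q (e : {mpoly K[p.+1 * q.+1]}) : Prop :=
  exists (i k i' k' : 'I_p.+1) (j l j' l' : 'I_q.+1),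
    [/\ (i + k = i' + k')%N, (j + l = j' + l')%N &
        e = quadric (mxvec_index i j) (mxvec_index k l)
                    (mxvec_index i' j') (mxvec_index k' l')].

Lemma veronese_relation p (v : 'rV[K]_2) (i k i' k' : 'I_p.+1) : (i + k = i' + k')%N ->
  veronese p v 0 i * veronese p v 0 k = veronese p v 0 i' * veronese p v 0 k'.
Proof.
move=> e; rewrite !mxE !mulrA -![_ * _ * v 0 0 ^+ _]mulrAC -!exprD -!mulrA -!exprD e.
congr (_ * _ ^+ _); have := ltn_ord i; have := ltn_ord k.
by have := ltn_ord i'; have := ltn_ord k'; lia.
Qed.

Lemma bimon_section_image p q (z : 'rV[K]_(p.+2 * q.+2).-1.+1) : z != 0 ->
  in_image (@bimon_section p.+1 q.+1) z <->
  forall e, @bimon_relation p.+1 q.+1 e -> at_point e z = 0.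
Proof.
move=> z_neq0; split=> [[P [c c_neq0 ->]] e | rel].
  move=> [i [k [i' [k' [j [l [j' [l' [ei ej ->]]]]]]]]].
  have zE (i1 : 'I_p.+2) (j1 : 'I_q.+2) :
      (c *: proj_map (@bimon_section p.+1 q.+1) P) 0 (mxvec_index i1 j1) =
      c * (veronese p.+1 (px P) 0 i1 * veronese q.+1 (py P) 0 j1).
    by rewrite mxE proj_map_bimon.
  rewrite at_point_quadric !zE.
  apply/eqP; rewrite subr_eq0; apply/eqP.
  transitivity (c ^+ 2 * (veronese p.+1 (px P) 0 i * veronese p.+1 (px P) 0 k) *
     (veronese q.+1 (py P) 0 j * veronese q.+1 (py P) 0 l)); first by ring.
  by rewrite (veronese_relation _ ei) (veronese_relation _ ej); ring.
have [||c [v [w [c_neq0 v_neq0 w_neq0 ZE]]]] :=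
  @segre_veronese p q (vec_mx (z : 'rV_(p.+2 * q.+2))).
- by rewrite vec_mx_eq0.
- move=> i k i' k' j l j' l' ei ej; rewrite !mxE; apply/eqP; rewrite -subr_eq0.
  rewrite -(at_point_quadric (mxvec_index i j) _ _ _ z); apply/eqP/rel.
  by exists i, k, i', k', j, l, j', l'.
exists (Bipoint v_neq0 w_neq0), c => //; apply/rowP => k.
case/mxvec_indexP: (k : 'I_(p.+2 * q.+2)) => i j.
by rewrite mxE proj_map_bimon -ZE mxE.
Qed.

(** Fix monomials that do not vanish at P0. Two coordinates that differ only by exchanging a factor
    x0 for x1 are a common multiple of x0 and x1, and likewise for y, so linear forms suffice for
    the inverse near P0. *)
Lemma bimon_section_inverse p q P0 :
  exists G G' : 'I_2 -> {mpoly K[(p.+2 * q.+2).-1.+1]},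
    let g P := \row_i at_point (G i) (proj_map (@bimon_section p.+1 q.+1) P) in
    let g' P := \row_i at_point (G' i) (proj_map (@bimon_section p.+1 q.+1) P) in
    [/\ forall i, G i \is 1.-homog /\ G' i \is 1.-homog,
        g P0 != 0 /\ g' P0 != 0 &
        forall P, g P != 0 -> g' P != 0 ->
          same_point (g P) (px P) /\ same_point (g' P) (py P)].
Proof.
have [i0 xi0] := veronese_neq0 p (px_neq0 P0).
have [j0 yj0] := veronese_neq0 q (py_neq0 P0).
have [i1 xi1] := veronese_neq0 p.+1 (px_neq0 P0).
have [j1 yj1] := veronese_neq0 q.+1 (py_neq0 P0).
(* [step n i k] is the index, in degree n + 1, of v_k times the monomial of index i in degree n. *)
pose step n (i : 'I_n.+1) (k : 'I_2) : 'I_n.+2 :=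
  if k == 0 then lift ord0 i else widen_ord (leqnSn _) i.
have stepE n (v : 'rV[K]_2) (i : 'I_n.+1) k :
    veronese n.+1 v 0 (step n i k) = veronese n v 0 i * v 0 k.
  by have [e0 e1] := veronese_S v i; have [->|->] := ord2P k; rewrite /step /= ?e0 ?e1.
exists (fun k => 'X_(mxvec_index (step p i0 k) j1 : 'I_(p.+2 * q.+2))).
exists (fun k => 'X_(mxvec_index i1 (step q j0 k) : 'I_(p.+2 * q.+2))).
move=> g g'.
have gE P : g P = (veronese p (px P) 0 i0 * veronese q.+1 (py P) 0 j1) *: px P.
  by apply/rowP => k; rewrite [LHS]mxE at_point_X proj_map_bimon stepE [RHS]mxE mulrAC.
have g'E P : g' P = (veronese p.+1 (px P) 0 i1 * veronese q (py P) 0 j0) *: py P.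
  by apply/rowP => k; rewrite [LHS]mxE at_point_X proj_map_bimon stepE [RHS]mxE mulrA.
split=> [i | | P].
- by split; rewrite dhomogX; apply/eqP; exact: mdeg1.
- by rewrite gE g'E !scaler_eq0 !mulf_eq0 !negb_or xi0 yj0 xi1 yj1 px_neq0 py_neq0.
rewrite gE g'E !scaler_eq0 !negb_or => /andP[c_neq0 _] /andP[c'_neq0 _].
by split; [exists (veronese p (px P) 0 i0 * veronese q.+1 (py P) 0 j1)
          |exists (veronese p.+1 (px P) 0 i1 * veronese q (py P) 0 j0)].
Qed.

Lemma very_ample_gt0 (p q : nat) : very_ample K p.+1 q.+1.
Proof.
exists (p.+2 * q.+2).-1, (@bimon_section p.+1 q.+1); split.
  by move=> k; apply: (@bihomog_bimons K p.+1 q.+1 k).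
split=> [P | | P0].
- have [i xi] := veronese_neq0 p.+1 (px_neq0 P).
  have [j yj] := veronese_neq0 q.+1 (py_neq0 P).
  by apply/rV0Pn; exists (mxvec_index i j); rewrite proj_map_bimon mulf_neq0.
- exists (@bimon_relation p.+1 q.+1); last exact: bimon_section_image.
  move=> _ [i [k [i' [k' [j [l [j' [l' [_ _ ->]]]]]]]]]; exists 2%N.
  by rewrite rpredB // (@dhomogM _ _ _ 1 _ 1) // dhomogX; apply/eqP; exact: mdeg1.
by have [G [G' ?]] := bimon_section_inverse p q P0; exists 1%N, 1%N, G, G'.
Qed.

(** Either p or q is negative and F = 0, or p = 0 and only the monomials with no x occur. *)
Lemma at_bipoint_px (p q : int) F P P' : p <= 0 -> bihomog p q F ->
  py P = py P' -> at_bipoint F P = at_bipoint F P'.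
Proof.
move=> p_le0 homF ey; have [neg|] := boolP ((p < 0) || (q < 0)).
  by rewrite (bihomog_neg neg homF) /at_bipoint !meval0.
case: p q p_le0 homF => [[|//]|//] [q|//] _ homF _.
rewrite !(at_bipoint_sum _ homF) ey; apply: eq_bigr => i _; apply: eq_bigr => j _.
by rewrite !mxE [i]ord1.
Qed.

Lemma at_bipoint_py (p q : int) F P P' : q <= 0 -> bihomog p q F ->
  px P = px P' -> at_bipoint F P = at_bipoint F P'.
Proof.
move=> q_le0 homF ex; have [neg|] := boolP ((p < 0) || (q < 0)).
  by rewrite (bihomog_neg neg homF) /at_bipoint !meval0.
case: p q q_le0 homF => [p|//] [[|//]|//] _ homF _.
rewrite !(at_bipoint_sum _ homF) ex; apply: eq_bigr => i _; apply: eq_bigr => j _.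
by rewrite !mxE [j]ord1.
Qed.

(** The forms inverting the map near P take the same values u and w at P and at P', since the two
    images have equal coordinates; u and w then represent both points. *)
Lemma closed_embedding_inj N (s : 'I_N.+1 -> {mpoly K[2 + 2]}) P P' :
  closed_embedding s -> proj_map s P = proj_map s P' ->
  exists u w : 'rV[K]_2, [/\ same_point u (px P) /\ same_point u (px P') &
                            same_point w (py P) /\ same_point w (py P')].
Proof.
move=> [_ _ /(_ P)[d [d' [G [G' [_ [g_neq0 g'_neq0] inv]]]]]] e.
have [xP yP] := inv P g_neq0 g'_neq0.
have := inv P'; rewrite -e => /(_ g_neq0 g'_neq0)[xP' yP'].
by do 2!eexists; split; split; eassumption.
Qed.

Lemma delta_same_point (u : 'rV[K]_2) :
  same_point u (delta_mx 0 0) -> same_point u (delta_mx 0 1) -> False.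
Proof.
move=> [c c_neq0 ->] [c' _ /rowP/(_ 0)]; rewrite !mxE /= mulr1 mulr0.
by move/eqP; rewrite (negPf c_neq0).
Qed.

Lemma delta_neq0 (i : 'I_2) : delta_mx 0 i != 0 :> 'rV[K]_2.
Proof. by apply/rV0Pn; exists i; rewrite mxE !eqxx oner_eq0. Qed.

Lemma very_ample_sgn (p q : int) : very_ample K p q -> 0 < p /\ 0 < q.
Proof.
move=> [N [s [homs emb]]]; rewrite !ltNge; split; apply/negP => le0.
  (* The points [1 : 0] and [0 : 1] of one fibre have the same image when p <= 0. *)
  pose P i := Bipoint (delta_neq0 i) (delta_neq0 0).
  have [|u [w [[u0 u1] _]]] := @closed_embedding_inj _ s (P 0) (P 1) emb.
    by apply/rowP => i; rewrite !mxE; apply: at_bipoint_px (homs i) _.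
  exact: delta_same_point u0 u1.
pose P i := Bipoint (delta_neq0 0) (delta_neq0 i).
have [|u [w [_ [w0 w1]]]] := @closed_embedding_inj _ s (P 0) (P 1) emb.
  by apply/rowP => i; rewrite !mxE; apply: at_bipoint_py (homs i) _.
exact: delta_same_point w0 w1.
Qed.

Lemma ampleZ_gt0 (p q : int) : ampleZ K p q <-> 0 < p /\ 0 < q.
Proof.
split=> [[k k_gt0 /very_ample_sgn] | []]; first by rewrite !pmulrn_lgt0.
case: p q => [[//|p]|//] [[//|q]|//] _ _.
by exists 1%N => //; rewrite !mulr1n; apply: very_ample_gt0.
Qed.

Lemma ample_gt0 (L : PicQ) : ample K L <-> 0 < L 0 0 /\ 0 < L 0 1.
Proof.
split=> [[r [p [q [r_gt0 eL /ampleZ_gt0 amplepq]]]]|].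
  by have [-> ->] := classZ_sgn r_gt0 eL.
have [r [p [q [r_gt0 eL]]]] := classZ_multiple L.
have [-> ->] := classZ_sgn r_gt0 eL.
by move=> /ampleZ_gt0 amplepq; exists r, p, q.
Qed.

End Ample.

(** * Factors of homogeneous polynomials *)

(** If n > 0, the product vanishes at 0, so one factor does, and a factor X can be cancelled. If n =
    0, both factors are constants. *)
Lemma poly_factor_monomial (R : idomainType) (f g : {poly R}) (c : R) n :
  c != 0 -> f * g = c *: 'X^n ->
  exists d e (a b : R), [/\ n = (d + e)%N, f = a *: 'X^d & g = b *: 'X^e].
Proof.
move=> c_neq0; elim: n f g => [|n IHn] f g fg.
  have : size (f * g) == 1%N by rewrite fg expr0 alg_polyC size_polyC c_neq0.
  rewrite size_mul_eq1 => /andP[/size_poly1P[a _ ->] /size_poly1P[b _ ->]].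
  by exists 0%N, 0%N, a, b; rewrite !expr0 !alg_polyC.
have X_inj : injective (fun h : {poly R} => h * 'X) by apply: mulIf; rewrite polyX_eq0.
have : root (f * g) 0 by rewrite fg rootE hornerZ hornerXn expr0n mulr0.
rewrite rootM => /orP[] /factor_theorem[h]; rewrite subr0 => hE.
  have /IHn[d [e [a [b [-> hE' ->]]]]] : h * g = c *: 'X^n.
    by apply: X_inj; rewrite /= -scalerAl -exprSr -fg hE mulrAC.
  by exists d.+1, e, a, b; rewrite hE hE' -scalerAl -exprSr.
have /IHn[d [e [a [b [-> -> hE']]]]] : f * h = c *: 'X^n.
  by apply: X_inj; rewrite /= -scalerAl -exprSr -fg hE mulrA.
by exists d, e.+1, a, b; rewrite hE hE' -scalerAl -exprSr addnS.
Qed.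

Section HomogeneousFactor.

Variables (R : idomainType) (n : nat) (mf : measure n).
Implicit Types F G H : {mpoly R[n]}.

(* F(t^w x), with w the weights of the variables: the coefficient of t^d is the component
   of weight d, so F is homogeneous when graded F is a monomial in t. *)
Definition graded F : {poly {mpoly R[n]}} :=
  mmap (polyC \o @mpolyC n R) (fun i => ('X_i)%:P * 'X^(mf U_(i)%MM)) F.

Lemma gradedM : {morph graded : G H / G * H}.
Proof. exact: rmorphM. Qed.

Lemma gradedE F : graded F = \sum_(m <- msupp F) (F@_m *: 'X_[m])%:P * 'X^(mf m).
Proof.
rewrite /graded /mmap; apply: eq_bigr => m _.
rewrite -mul_mpolyC rmorphM /= -mulrA; congr (_ * _).
rewrite /mmap1 mpolyXE_id rmorph_prod mfE -prodrXr -big_split /=.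
by apply: eq_bigr => i _; rewrite exprMn rmorphXn mulnC exprM.
Qed.

Lemma coef_graded F d m : (graded F)`_d@_m = F@_m *+ (mf m == d).
Proof.
rewrite gradedE coef_sum raddf_sum /=.
rewrite (eq_bigr (fun m' => (F@_m' *: 'X_[m'] *+ (mf m' == d))@_m)) => [|m' _].
  rewrite [in RHS](mpolyE F) raddf_sum -sumrMnl /=; apply: eq_bigr => m' _.
  rewrite mcoeffMn mcoeffZ mcoeffX.
  by have [->|] := eqVneq m' m; rewrite ?mulr0 ?mul0rn.
by rewrite coefCM coefXn eq_sym mulr_natr.
Qed.

Lemma dhomog_graded F d : F \is d.-homog for mf -> graded F = F *: 'X^d.
Proof.
move=> /dhomogP homF; apply/polyP => e; apply/mpolyP => m.
rewrite coef_graded coefZ coefXn mulr_natr mcoeffMn.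
have [mF|/memN_msupp_eq0->] := boolP (m \in msupp F); last by rewrite !mul0rn.
by rewrite (homF _ mF) eq_sym.
Qed.

Lemma graded_dhomog F G d : graded F = G *: 'X^d -> F \is d.-homog for mf.
Proof.
move=> gF; apply/dhomogP => m; rewrite mcoeff_msupp => Fm; apply/eqP.
apply: contraNT Fm => ne_d; have := coef_graded F (mf m) m.
by rewrite gF coefZ coefXn (negPf ne_d) mulr0 mcoeff0 eqxx mulr1n => <-.
Qed.

(** Since [graded] is multiplicative, the images of G and H multiply to a nonzero monomial in t, so
    each is a monomial in t, that is, each factor is homogeneous. *)
Lemma dhomog_factor G H d : G * H != 0 -> G * H \is d.-homog for mf ->
  exists d1 d2, [/\ d = (d1 + d2)%N, G \is d1.-homog for mf & H \is d2.-homog for mf].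
Proof.
move=> GH_neq0 /dhomog_graded; rewrite gradedM.
case/(poly_factor_monomial GH_neq0) => d1 [d2 [a [b [-> gG gH]]]].
by exists d1, d2; split=> //; [apply: graded_dhomog gG | apply: graded_dhomog gH].
Qed.

End HomogeneousFactor.

Lemma mpoly_unitE (R : idomainType) n (G : {mpoly R[n]}) :
  G \is a GRing.unit = (msize G == 1%N) && (G@_0 \is a GRing.unit).
Proof.
rewrite [LHS]/(mpoly_unit G) /mpoly_unit; have [Gu|] := boolP (G@_0 \is a _).
  rewrite !andbT; apply/eqP/eqP => [->|].
    by rewrite msizeC; case: eqP Gu => // ->; rewrite unitr0.
  by move=> s1; apply: msize1_polyC; rewrite s1.
by rewrite !andbF.
Qed.

Lemma mpoly_field_unitE (K : fieldType) n (G : {mpoly K[n]}) :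
  G \is a GRing.unit = (msize G == 1%N).
Proof.
rewrite mpoly_unitE; case: eqP => //= /eqP/msize_poly1P[c c_neq0 ->].
by rewrite mcoeffC eqxx mulr1 unitfE.
Qed.

(** Total degree is additive on nonzero polynomials, so one factor of a polynomial of degree 1 has
    degree 0 and is a unit. *)
Lemma irreducible_X (K : fieldType) n (k : 'I_n) : irreducible_mpoly ('X_k : {mpoly K[n]}).
Proof.
have X_neq0 : 'X_k != 0 :> {mpoly K[n]} by rewrite -msize_poly_eq0 msizeX.
split=> // [|G H e]; first by rewrite mpoly_field_unitE msizeX mdeg1.
have: G * H != 0 by rewrite -e.
rewrite mulf_eq0 negb_or => /andP[G_neq0 H_neq0].
have := msizeM G_neq0 H_neq0; rewrite -e msizeX mdeg1 !mpoly_field_unitE.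
rewrite (mpolySpred _ G_neq0) (mpolySpred _ H_neq0) => eq2.
by case: eqP => [|neG]; [left | right; apply/eqP; lia].
Qed.

(** * Irreducible curves *)

Section Nef.

Variable K : fieldType.

Lemma X_curve (c d : nat) (k : 'I_(2 + 2)) : bihomog c d ('X_k : {mpoly K[2 + 2]}) ->
  curve_equation (fun P : bipoint K => at_bipoint 'X_k P = 0) c d 'X_k.
Proof. by move=> homX; split=> //; apply: irreducible_X. Qed.

Lemma nef_ge0 (L : PicQ) : nef K L <-> 0 <= L 0 0 /\ 0 <= L 0 1.
Proof.
split=> [nefL | [x_ge0 y_ge0] C c d _]; last first.
  by rewrite intersection_classZ addr_ge0 // mulr_ge0 ?ler0n.
(* The fibre x0 = 0 has type (1, 0) and meets L in its second coordinate; the fibre y0 = 0 below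
   yields the first. *)
have /nefL : irreducible_curve (fun P : bipoint K => at_bipoint 'X_(lshift 2 0) P = 0) 1 0.
  by eexists; apply/X_curve/bihomog_x.
have /nefL : irreducible_curve (fun P : bipoint K => at_bipoint 'X_(rshift 2 0) P = 0) 0 1.
  by eexists; apply/X_curve/bihomog_y.
by rewrite !intersection_classZ !mulr0 !mulr1 add0r addr0.
Qed.

End Nef.

Lemma msize_bihomog (K : fieldType) (p q : nat) (F : {mpoly K[2 + 2]}) :
  F != 0 -> bihomog p q F -> msize F = (p + q).+1.
Proof.
move=> F_neq0 /bihomogP[/dhomogP homx /dhomogP homy].
rewrite -mlead_deg // mdegE big_split_ord /=; have := mlead_supp F_neq0 => mF.
by rewrite -(homx _ mF) -(homy _ mF).
Qed.

Lemma mderivXn (R : comNzRingType) n (i : 'I_n) (F : {mpoly R[n]}) k :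
  (F ^+ k)^`M(i) = F^`M(i) * F ^+ k.-1 *+ k.
Proof.
elim: k => [|k IHk]; first by rewrite expr0 -mpolyC1 mderivC.
rewrite exprS mderivM IHk mulrnAr mulrCA mulrS; congr (_ + _).
by case: k {IHk} => [|k]; rewrite ?mulr0n // -exprS.
Qed.

Lemma mderivXU (R : nzRingType) n (i k : 'I_n) : 'X_k^`M(i) = (i == k)%:R :> {mpoly R[n]}.
Proof.
rewrite mderivX mnm1E eq_sym; case: eqP => [->|_]; rewrite ?scale0r // scale1r.
by rewrite (_ : (_ - _)%MM = 0%MM) ?mpolyX0 //; apply/mnmP => j; rewrite mnmBE subnn mnm0E.
Qed.

(** * Binary forms and zeros on fibres *)

Section Binary.

Variable K : fieldType.

(** Homogenization of f in degree n, faithful when size f <= n + 1. The point x1 = 0 is at infinity,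
    so a drop in degree shows as a factor x1. *)
Definition binary n (f : {poly K}) : {mpoly K[2 + 2]} :=
  \sum_(i < n.+1) f`_i *: ('X_(lshift 2 0) ^+ i * 'X_(lshift 2 1) ^+ (n - i)).

Implicit Types f g : {poly K}.

Lemma binary_mulX n f : binary n.+1 (f * 'X) = 'X_(lshift 2 0) * binary n f.
Proof.
rewrite /binary big_ord_recl coefMX scale0r add0r mulr_sumr; apply: eq_bigr => i _.
by rewrite lift0 coefMX /= subSS -scalerAr mulrA -exprS.
Qed.

Lemma binary_lift n f : (size f <= n.+1)%N -> binary n.+1 f = 'X_(lshift 2 1) * binary n f.
Proof.
move=> le_f; rewrite /binary big_ord_recr /= nth_default // scale0r addr0 mulr_sumr.
apply: eq_bigr => i _; rewrite -scalerAr mulrCA -exprS subSn // -ltnS ltn_ord //.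
Qed.

Lemma binaryB n f g : binary n (f - g) = binary n f - binary n g.
Proof. by rewrite /binary -sumrB; apply: eq_bigr => i _; rewrite coefB scalerBl. Qed.

Lemma binaryZ n c f : binary n (c *: f) = c *: binary n f.
Proof. by rewrite /binary scaler_sumr; apply: eq_bigr => i _; rewrite coefZ scalerA. Qed.

Lemma bihomog_binary (a : nat) (F : {mpoly K[2 + 2]}) : bihomog a 0%N F ->
  F = binary a (\poly_(i < a.+1) F@_(bimon a 0 i 0)).
Proof.
move=> homF; rewrite {1}(bihomog_sum homF); apply: eq_bigr => i _.
rewrite big_ord_recl big_ord0 addr0 coef_poly ltn_ord; congr (_ *: _).
rewrite mpolyXE_id big_split_ord /= !big_ord_recl !big_ord0 !bimon_x !bimon_y /=.
by rewrite !expr0 !mulr1; congr (_ * 'X_(lshift 2 _) ^+ _); apply: val_inj.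
Qed.

End Binary.

Section ClosedField.

Variable K : closedFieldType.
Implicit Types (F G H : {mpoly K[2 + 2]}) (P : bipoint K).

(** Over a closed field a binary form of positive degree has a linear factor; irreducibility makes
    the cofactor a constant, and comparing degrees gives a = 1. *)
Lemma irreducible_bihomog_binary (a : nat) F :
  bihomog a 0%N F -> irreducible_mpoly F -> a = 1%N.
Proof.
move=> homF [F_neq0 F_nonunit F_irr].
have sF := msize_bihomog F_neq0 homF; rewrite addn0 in sF.
case: a homF sF => [|a] homF sF; first by rewrite mpoly_field_unitE sF in F_nonunit.
set f := \poly_(i < a.+2) F@_(bimon a.+1 0 i 0).
have s_f : (size f <= a.+2)%N := size_poly _ _.
have FE : F = binary a.+1 f := bihomog_binary homF.
suff [l [H [lH sl]]] : exists l H, F = l * H /\ msize l = 2%N.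
  case: (F_irr l H lH) => [|Hu]; first by rewrite mpoly_field_unitE sl.
  move: F_neq0; rewrite lH mulf_eq0 negb_or => /andP[l_neq0 H_neq0].
  move: Hu; rewrite mpoly_field_unitE => /eqP sH.
  by have := msizeM l_neq0 H_neq0; rewrite -lH sF sl sH => -[->].
(* Only a nonzero constant f has no root; then F vanishes at infinity and x1 divides it. A root r
   gives the factor x0 - r x1. *)
have [/eqP f1|/closed_rootP[r /factor_theorem[g fE]]] := boolP (size f == 1%N).
  exists 'X_(lshift 2 1), (binary a f); split; last by rewrite msizeX mdeg1.
  by rewrite FE binary_lift // f1.
exists ('X_(lshift 2 0) - r *: 'X_(lshift 2 1)), (binary a g); split.
  have s_g : (size g <= a.+1)%N.
    have [->|g_neq0] := eqVneq g 0; first by rewrite size_poly0.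
    by move: s_f; rewrite fE size_mul ?polyXsubC_eq0 // size_XsubC addn2.
  rewrite FE fE mulrBr [g * r%:P]mulrC mul_polyC binaryB binaryZ binary_mulX.
  by rewrite binary_lift // mulrBl scalerAl.
have neq0 : 'X_(lshift 2 0) - r *: 'X_(lshift 2 1) != 0 :> {mpoly K[2 + 2]}.
  apply/eqP => /(congr1 (mcoeff U_(lshift 2 0))) /eqP.
  by rewrite mcoeffB mcoeffZ !mcoeffXU eqxx eq_lshift /= mulr0 subr0 mcoeff0 oner_eq0.
rewrite (@msize_bihomog _ 1 0) //.
exact/bihomogB/bihomogZ/bihomog_x/bihomog_x.
Qed.

(** If the leading coefficient is zero, [1 : 0] is a zero. Otherwise the dehomogenization has degree
    p + 1 > 0, and a root r of it gives the zero [r : 1]. *)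
Lemma binary_form_root p (c : 'I_p.+2 -> K) :
  exists2 v : 'rV[K]_2, v != 0 & \sum_i c i * veronese p.+1 v 0 i = 0.
Proof.
pose f := \poly_(i < p.+2) c (inord i).
have [c_max|c_max] := eqVneq (c ord_max) 0.
  exists (delta_mx 0 0); first exact: delta_neq0.
  apply: big1 => i _; rewrite !mxE /= expr1n mul1r.
  have [->|ne_i] := eqVneq i ord_max; first by rewrite c_max mul0r.
  rewrite expr0n subn_eq0 leqNgt (_ : (i < p.+1)%N) ?mulr0 //.
  by have := ltn_ord i; rewrite -val_eqE /= in ne_i; lia.
have size_f : size f = p.+2.
  by apply: size_poly_eq; rewrite (_ : inord _ = ord_max) //; apply/val_inj/inordK.
have /closed_rootP[r /rootP fr] : size f != 1%N by rewrite size_f.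
pose v : 'rV[K]_2 := \row_i (if i == 0 then r else 1).
exists v; first by apply/rV0Pn; exists 1; rewrite mxE oner_eq0.
rewrite -[RHS]fr horner_poly; apply: eq_bigr => i _.
by rewrite !mxE /= expr1n mulr1 inord_val.
Qed.

(** On the fibre over w, F restricts to a binary form in x of positive degree. *)
Lemma root_px (p q : nat) F (w : 'rV[K]_2) : bihomog p.+1 q F -> w != 0 ->
  exists2 P, py P = w & at_bipoint F P = 0.
Proof.
move=> homF w_neq0.
have [v v_neq0 e] := @binary_form_root p (fun i => \sum_(j < q.+1)
  F@_(bimon p.+1 q i j) * veronese q w 0 j).
exists (Bipoint v_neq0 w_neq0) => //; rewrite (at_bipoint_sum _ homF) -[RHS]e.
apply: eq_bigr => i _; rewrite mulr_suml; apply: eq_bigr => j _ /=.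
by rewrite mulrAC mulrA.
Qed.

Lemma root_py (p q : nat) F (v : 'rV[K]_2) : bihomog p q.+1 F -> v != 0 ->
  exists2 P, px P = v & at_bipoint F P = 0.
Proof.
move=> homF v_neq0.
have [w w_neq0 e] := @binary_form_root q (fun j => \sum_(i < p.+1)
  F@_(bimon p q.+1 i j) * veronese p v 0 i).
exists (Bipoint v_neq0 w_neq0) => //; rewrite (at_bipoint_sum _ homF) -[RHS]e.
rewrite exchange_big /=; apply: eq_bigr => j _; rewrite mulr_suml.
by apply: eq_bigr => i _; rewrite mulrA.
Qed.

(** Lets a zero found on a fibre be moved to a chosen representative of the same point. *)
Lemma at_bipoint_scale_px (p q : nat) F P P' (c : K) : bihomog p q F ->
  px P = c *: px P' -> py P = py P' -> at_bipoint F P = c ^+ p * at_bipoint F P'.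
Proof.
move=> homF ex ey; rewrite !(at_bipoint_sum _ homF) ex ey mulr_sumr.
apply: eq_bigr => i _; rewrite mulr_sumr; apply: eq_bigr => j _.
have -> : c ^+ p = c ^+ i * c ^+ (p - i) by rewrite -exprD subnKC // -ltnS.
rewrite !mxE !exprMn; ring.
Qed.

End ClosedField.

(** * Smooth irreducible curves of type (a, b) with a, b > 0 *)

Section SmoothCurve.

Variable K : closedFieldType.
Hypothesis charK0 : [pchar K] =i pred0.
Implicit Types (F G H : {mpoly K[2 + 2]}) (P : bipoint K).

Local Notation x0 := ('X_(lshift 2 0) : {mpoly K[2 + 2]}).
Local Notation x1 := ('X_(lshift 2 1) : {mpoly K[2 + 2]}).
Local Notation y0 := ('X_(rshift 2 0) : {mpoly K[2 + 2]}).
Local Notation y1 := ('X_(rshift 2 1) : {mpoly K[2 + 2]}).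

(** Regrouped, this is y0^b (x0^a + x1^a) + y1^b (x1^a - x0^a). Both groupings separate the
    variables, so each partial derivative is a monomial in one variable times a binary form in the
    other pair. *)
Definition pencil (a b : nat) : {mpoly K[2 + 2]} :=
  x0 ^+ a * (y0 ^+ b - y1 ^+ b) + x1 ^+ a * (y0 ^+ b + y1 ^+ b).

Lemma bihomog_pencil (a b : nat) : bihomog a b (pencil a b).
Proof.
have hx k : bihomog a 0%N ('X_(lshift 2 k) ^+ a : {mpoly K[2 + 2]}).
  by have := @bihomogXn K 1 0 _ a (@bihomog_x K k); rewrite mul1n.
have hy k : bihomog 0%N b ('X_(rshift 2 k) ^+ b : {mpoly K[2 + 2]}).
  by have := @bihomogXn K 0 1 _ b (@bihomog_y K k); rewrite mul1n.
rewrite -[Posz a]/(Posz (0 + a)%N) addnC.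
apply: bihomogD; apply: (bihomogM (q := 0)); rewrite ?hx //.
  exact: bihomogB.
exact: bihomogD.
Qed.

Lemma at_pencil a b P : at_bipoint (pencil a b) P =
  px P 0 0 ^+ a * (py P 0 0 ^+ b - py P 0 1 ^+ b) +
  px P 0 1 ^+ a * (py P 0 0 ^+ b + py P 0 1 ^+ b).
Proof.
rewrite /at_bipoint /pencil !(rmorphD, rmorphN, rmorphM, rmorphXn) /= !mevalXU.
by rewrite !row_mxEl !row_mxEr.
Qed.

Lemma mderiv_pencil_x a b (k : 'I_2) P :
  at_bipoint (pencil a b)^`M(lshift 2 k) P =
  (px P 0 k ^+ a.-1 *+ a) *
  (if k == 0 then py P 0 0 ^+ b - py P 0 1 ^+ b else py P 0 0 ^+ b + py P 0 1 ^+ b).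
Proof.
rewrite /pencil mderivD !mderivM mderivB mderivD !mderivXn !mderivXU !eq_lshift !eq_lrshift.
have [->|->] := ord2P k; rewrite /= !(mul0r, mul0rn, mulr0, subr0, addr0, add0r, mul1r);
  rewrite /at_bipoint !(rmorphD, rmorphN, rmorphM, rmorphXn, rmorphMn) /= !mevalXU;
  by rewrite !row_mxEl !row_mxEr ?meval0; ring.
Qed.

Lemma mderiv_pencil_y a b (k : 'I_2) P :
  at_bipoint (pencil a b)^`M(rshift 2 k) P =
  (py P 0 k ^+ b.-1 *+ b) *
  (if k == 0 then px P 0 0 ^+ a + px P 0 1 ^+ a else px P 0 1 ^+ a - px P 0 0 ^+ a).
Proof.
rewrite /pencil mderivD !mderivM mderivB mderivD !mderivXn !mderivXU !eq_rshift !eq_rlshift.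
have [->|->] := ord2P k; rewrite /= !(mul0r, mul0rn, mulr0, subr0, addr0, add0r, sub0r, mul1r);
  rewrite /at_bipoint !(rmorphD, rmorphN, rmorphM, rmorphXn, rmorphMn) /= !mevalXU;
  by rewrite !row_mxEl !row_mxEr ?meval0; ring.
Qed.

Lemma addrr_eq0 (t : K) : t + t = 0 -> t = 0.
Proof.
move/pcharf0P: charK0 => char0 /eqP.
by rewrite -mulr2n -mulr_natr mulf_eq0 char0 orbF => /eqP.
Qed.

(** The two powers are both equal and opposite, and 2 is invertible. *)
Lemma no_common_zero n (v : 'rV[K]_2) : (0 < n)%N -> v != 0 ->
  v 0 0 ^+ n - v 0 1 ^+ n = 0 -> v 0 0 ^+ n + v 0 1 ^+ n = 0 -> False.
Proof.
move=> n_gt0 /eqP v_neq0 /eqP; rewrite subr_eq0 => /eqP e; rewrite -e => /addrr_eq0 v0.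
have v1 : v 0 1 ^+ n = 0 by rewrite -e.
by apply: v_neq0; apply: row2P; apply/eqP; rewrite mxE; [move/eqP: v0 | move/eqP: v1];
  rewrite expf_eq0 n_gt0.
Qed.

(** In characteristic 0 the factors a and b of the derivatives cancel. If one of x0, x1 is zero, the
    y-derivatives force y0 = y1 = 0; if neither is, the x-derivatives give a common zero of y0^b -
    y1^b and y0^b + y1^b. *)
Lemma pencil_smooth a b P : (0 < a)%N -> (0 < b)%N ->
  (forall i, at_bipoint (pencil a b)^`M(i) P = 0) -> False.
Proof.
move/pcharf0P: charK0 => char0 a_gt0 b_gt0 sing.
have expr_eq0 (t : K) n : t ^+ n = 0 -> t = 0.
  by move/eqP; rewrite expf_eq0 => /andP[_ /eqP].
have cancel (t c : K) n k : (0 < k)%N -> (t ^+ n *+ k) * c = 0 -> t = 0 \/ c = 0.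
  move=> k_gt0 /eqP; rewrite -mulr_natr !mulf_eq0 char0 (gtn_eqF k_gt0) orbF.
  by case/orP => /eqP h; [left; apply: expr_eq0 h | right].
have x_eq0 k := cancel _ _ _ _ a_gt0 (etrans (esym (mderiv_pencil_x a b k P)) (sing _)).
have y_eq0 k := cancel _ _ _ _ b_gt0 (etrans (esym (mderiv_pencil_y a b k P)) (sing _)).
have [px0 | px0_neq0] := eqVneq (px P 0 0) 0; have [px1 | px1_neq0] := eqVneq (px P 0 1) 0.
- by have /eqP[] := px_neq0 P; apply: row2P; rewrite mxE.
- case/eqP: (py_neq0 P); apply: row2P; rewrite mxE; [have := y_eq0 0 | have := y_eq0 1];
    rewrite /= px0 expr0n (gtn_eqF a_gt0) ?add0r ?subr0 => -[//|/expr_eq0/eqP];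
    by rewrite (negPf px1_neq0).
- case/eqP: (py_neq0 P); apply: row2P; rewrite mxE; [have := y_eq0 0 | have := y_eq0 1];
    rewrite /= px1 expr0n (gtn_eqF a_gt0) ?addr0 ?sub0r => -[//|/eqP];
    by rewrite ?oppr_eq0 => /eqP/expr_eq0/eqP; rewrite (negPf px0_neq0).
have [/eqP|] := x_eq0 0; first by rewrite (negPf px0_neq0).
have [/eqP|] := x_eq0 1; first by rewrite (negPf px1_neq0).
by move=> /= e1 e0; apply: (no_common_zero b_gt0 (py_neq0 P)).
Qed.

(** [pencil_smooth] does not ask P to lie on the curve, and the zero polynomial has vanishing
    derivatives at any point. *)
Lemma pencil_neq0 a b : (0 < a)%N -> (0 < b)%N -> pencil a b != 0.
Proof.
move=> a_gt0 b_gt0; apply/eqP => e.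
apply: (@pencil_smooth a b (Bipoint (delta_neq0 K 0) (delta_neq0 K 0))) => // i.
by rewrite e mderiv0 /at_bipoint meval0.
Qed.

(* If q > 0, then G vanishes on a fibre, which would lie over a common zero of
   y0^b - y1^b and y0^b + y1^b. *)
Lemma pencil_factor_y a b (q : nat) G H : (0 < a)%N -> (0 < b)%N ->
  bihomog 0 q G -> pencil a b = G * H -> q = 0%N.
Proof.
case: q => // q a_gt0 b_gt0 homG GH.
have [P _ GP] := root_py (p := 0) homG (delta_neq0 K 0).
(* At [1 : 0] and [0 : 1] the pencil reduces to y0^b - y1^b and y0^b + y1^b respectively. *)
have FP k : at_bipoint (pencil a b) (Bipoint (delta_neq0 K k) (py_neq0 P)) = 0.
  by rewrite GH at_bipointM (at_bipoint_px (P' := P) _ homG) // GP mul0r.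
have := FP 1; have := FP 0; rewrite !at_pencil !mxE /= !expr1n !expr0n (gtn_eqF a_gt0).
by rewrite !mul1r !mul0r addr0 add0r => e0 e1; case: (no_common_zero b_gt0 (py_neq0 P)).
Qed.

Lemma const_mx1_neq0 : const_mx 1 != 0 :> 'rV[K]_2.
Proof. by apply/rV0Pn; exists 0; rewrite mxE oner_eq0. Qed.

(* The pencil meets the fibre over [1 : 1] only in the point [1 : 0]. *)
Lemma pencil_factor_x a b (p q : nat) G H : bihomog p.+1 q G -> pencil a b = G * H ->
  at_bipoint G (Bipoint (delta_neq0 K 0) const_mx1_neq0) = 0.
Proof.
move=> homG GH; have [P eyP GP] := root_px homG const_mx1_neq0.
have := congr1 (fun F => at_bipoint F P) GH.
rewrite /= at_pencil at_bipointM GP mul0r.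
(* With y0 = y1 = 1 the equation becomes 2 x1^a = 0. *)
rewrite eyP !mxE !expr1n subrr mulr0 add0r mulrDr mulr1 => /addrr_eq0/eqP.
rewrite expf_eq0 => /andP[_ /eqP px1].
have exP : px P = px P 0 0 *: delta_mx 0 0.
  by apply: row2P; rewrite !mxE /= ?mulr1 ?mulr0.
have := at_bipoint_scale_px (P' := Bipoint (delta_neq0 K 0) const_mx1_neq0) homG exP eyP.
rewrite GP => /esym/eqP; rewrite mulf_eq0 => /orP[|/eqP //].
rewrite expf_eq0 => /andP[_ /eqP px0]; have /eqP[] := px_neq0 P.
by rewrite exP px0 scale0r.
Qed.

Lemma pencil_irreducible a b : (0 < a)%N -> (0 < b)%N -> irreducible_mpoly (pencil a b).
Proof.
move=> a_gt0 b_gt0; have F_neq0 := pencil_neq0 a_gt0 b_gt0.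
have homF := @bihomog_pencil a b; split=> // [|G H GH].
  by rewrite mpoly_field_unitE (msize_bihomog F_neq0 homF); lia.
have := F_neq0; rewrite GH mulf_eq0 negb_or => /andP[G_neq0 H_neq0].
move/bihomogP: homF => [Fx Fy]; rewrite GH in F_neq0 Fx Fy.
have [p [p' [ea Gx Hx]]] := dhomog_factor F_neq0 Fx.
have [q [q' [eb Gy Hy]]] := dhomog_factor F_neq0 Fy.
have homG : bihomog p q G by apply/bihomogP.
have homH : bihomog p' q' H by apply/bihomogP.
have HG : pencil a b = H * G by rewrite mulrC.
rewrite !mpoly_field_unitE (msize_bihomog G_neq0 homG) (msize_bihomog H_neq0 homH).
(* A factor of degree 0 in x also has degree 0 in y, so it is a unit. *)
case: p => [|p] in Gx homG ea *.
  by left; rewrite (pencil_factor_y a_gt0 b_gt0 homG GH).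
case: p' => [|p'] in Hx homH ea *.
  by right; rewrite (pencil_factor_y a_gt0 b_gt0 homH HG).
(* Both factors now have positive degree in x and vanish at ([1 : 0], [1 : 1]), so the Leibniz rule
   kills every derivative of the product there. *)
case: (@pencil_smooth a b (Bipoint (delta_neq0 K 0) const_mx1_neq0)) => // i.
have G0 := pencil_factor_x homG GH; have H0 := pencil_factor_x homH HG.
by rewrite GH mderivM at_bipointD !at_bipointM G0 H0 mulr0 mul0r addr0.
Qed.

Lemma pencil_smooth_irreducible_curve a b : (0 < a)%N -> (0 < b)%N ->
  smooth_irreducible_curve (fun P => at_bipoint (pencil a b) P = 0) a b.
Proof.
move=> a_gt0 b_gt0; exists (pencil a b).
  by split=> //; [apply: bihomog_pencil | apply: pencil_irreducible].
move=> P _; apply/existsP; rewrite -[X in is_true X]negbK negb_exists.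
apply/negP => /forallP sing.
by apply: (@pencil_smooth a b P) => // i; apply/eqP; have := sing i; rewrite negbK.
Qed.

Lemma fibre_smooth_irreducible_curve :
  smooth_irreducible_curve (fun P => at_bipoint x0 P = 0) 1 0.
Proof.
exists x0; first exact/X_curve/bihomog_x.
move=> P _; exists (lshift 2 0).
by rewrite mderivXU eqxx /at_bipoint rmorph1 oner_eq0.
Qed.

End SmoothCurve.

(** * Numerical criteria for the adjoint class, and the classification *)

Lemma adjoint_class_sgn (a b m : nat) : (0 < m)%N ->
  [/\ (0 < adjoint_class a b m 0 0) = (a * m.-1 < 2 * m)%N,
      (0 < adjoint_class a b m 0 1) = (b * m.-1 < 2 * m)%N,
      (0 <= adjoint_class a b m 0 0) = (a * m.-1 <= 2 * m)%N &
      (0 <= adjoint_class a b m 0 1) = (b * m.-1 <= 2 * m)%N].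
Proof.
case: m => // m _; have m_gt0 : 0 < m.+1%:R :> rat by rewrite ltr0n.
have m_neq0 := lt0r_neq0 m_gt0.
(* The coordinates are 2 - epsilon c = (2 m - c (m - 1)) / m for c = a and c = b, written here with
   m + 1 in place of m. *)
have coord c : (2 - epsilon m.+1 * c%:R) = ((2 * m.+1)%:R - (c * m)%:R) / m.+1%:R :> rat.
  by rewrite /epsilon !natrM -[m.+1]addn1 natrD in m_neq0 *; field.
have -> : adjoint_class a b m.+1 0 0 = ((2 * m.+1)%:R - (a * m)%:R) / m.+1%:R.
  by rewrite -coord !mxE /=; ring.
have -> : adjoint_class a b m.+1 0 1 = ((2 * m.+1)%:R - (b * m)%:R) / m.+1%:R.
  by rewrite -coord !mxE /=; ring.
by rewrite !pmulr_lgt0 ?pmulr_lge0 ?invr_gt0 // !subr_gt0 !subr_ge0 !ltr_nat !ler_nat.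
Qed.

Theorem propositionC2 (K : closedFieldType) (charK0 : [pchar K] =i pred0) :
  (forall (D : bipoint K -> Prop) (a b : nat),
      irreducible_curve D a b -> (b <= a)%N ->
      ((1 <= b)%N \/ (a, b) = (1, 0)%N) /\
      [/\ (* (1) *)
          (a <= 2)%N ->
            (a, b) \in types_le2 /\
            (forall m : nat, (2 <= m)%N -> ample K (adjoint_class a b m)),
          (* (2) *)
          a = 3%N ->
            (a, b) \in types_eq3 /\
            (forall m : nat, (2 <= m)%N ->
              [/\ ample K (adjoint_class a b m) <-> m = 2%N,
                  nef K (adjoint_class a b m) <-> m = 2%N \/ m = 3%N &
                  big K (adjoint_class a b m) <-> m = 2%N]),
          (* (3) *)
          a = 4%N ->
            (a, b) \in types_eq4 /\
            (forall m : nat, (2 <= m)%N ->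
              (nef K (adjoint_class a b m) <-> m = 2%N) /\
              (m = 2%N ->
                ~ ample K (adjoint_class a b m) /\
                ~ big K (adjoint_class a b m))) &
          (* (4) *)
          (5 <= a)%N ->
            forall m : nat, (2 <= m)%N -> ~ nef K (adjoint_class a b m)]) /\
  (forall a b : nat, (a, b) \in types_le2 ++ types_eq3 ++ types_eq4 ->
      exists D : bipoint K -> Prop, smooth_irreducible_curve D a b).
Proof.
split=> [D a b [F [homF F_irr _]] le_ba | a b]; last first.
  (* The only listed type with b = 0 is (1, 0), represented by a fibre; all others have a, b > 0 and
     are represented by the pencil. *)
  have [->|b_gt0 ab] := posnP b; last first.
    exists (fun P => at_bipoint (pencil K a b) P = 0).
    apply: pencil_smooth_irreducible_curve => //.
    by move: ab; rewrite !inE; case: a.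
  have [->|ne_a1] := eqVneq a 1%N; last by rewrite !inE !xpair_eqE (negPf ne_a1) !andbF.
  by move=> _; eexists; apply: fibre_smooth_irreducible_curve.
have ab : (0 < b)%N \/ a = 1%N /\ b = 0%N.
  have [b0|] := posnP b; [right | by left].
  by rewrite b0 in homF *; split=> //; apply: irreducible_bihomog_binary homF F_irr.
(* Since b <= a, the first coordinate is the smaller one and alone decides positivity. *)
have sgn m : (2 <= m)%N -> [/\ ample K (adjoint_class a b m) <-> (a * m.-1 < 2 * m)%N,
    nef K (adjoint_class a b m) <-> (a * m.-1 <= 2 * m)%N &
    big K (adjoint_class a b m) <-> (a * m.-1 < 2 * m)%N].
  move=> m_ge2; have [a1 b1 a2 b2] := adjoint_class_sgn a b (ltnW m_ge2).
  have le_bma : (b * m.-1 <= a * m.-1)%N by rewrite leq_mul2r le_ba orbT.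
  have gt0 : 0 < adjoint_class a b m 0 0 /\ 0 < adjoint_class a b m 0 1 <->
      (a * m.-1 < 2 * m)%N.
    by rewrite a1 b1; split=> [[]//|lt_a]; split=> //; apply: leq_ltn_trans lt_a.
  have ge0 : 0 <= adjoint_class a b m 0 0 /\ 0 <= adjoint_class a b m 0 1 <->
      (a * m.-1 <= 2 * m)%N.
    by rewrite a2 b2; split=> [[]//|le_a]; split=> //; apply: leq_trans le_a.
  split; [exact: iff_trans (ample_gt0 _ _) gt0 | exact: iff_trans (nef_ge0 _ _) ge0 |].
  exact: iff_trans (big_gt0 _ _) gt0.
split; first by case: ab => [|[-> ->]]; [left | right].
(* It remains to compare a (m - 1) with 2 m: always smaller for a <= 2; smaller iff m < 3 and equal
   at m = 3 for a = 3; equal at m = 2 and larger beyond for a = 4; always larger for a >= 5. *)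
split=> [le_a2 | a3 | a4 | ge_a5].
- split=> [|m m_ge2]; first by rewrite !inE !xpair_eqE; lia.
  by have [-> _ _] := sgn m m_ge2; nia.
- split=> [|m m_ge2]; first by rewrite !inE !xpair_eqE; lia.
  have [am nf bg] := sgn m m_ge2; rewrite a3 in am nf bg *.
  split; [apply: iff_trans am _ | apply: iff_trans nf _ | apply: iff_trans bg _]; lia.
- split=> [|m m_ge2]; first by rewrite !inE !xpair_eqE; lia.
  have [am nf bg] := sgn m m_ge2; rewrite a4 in am nf bg *.
  split=> [|m2]; first by apply: iff_trans nf _; lia.
  by split; [move/am | move/bg]; rewrite m2.
move=> m m_ge2; have [_ -> _] := sgn m m_ge2; nia.
Qed.
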